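(* Any random field is restored by its full conditional distribution. That is, if $P$ and $P'$ are (positive) random fields and there is a system $Q=\{Q_V^z, z\in\widehat{X_V}, V\in W\}$ which is a full conditional distribution both of $P$ and of $P'$, then $P=P'$.
   Context: $X\subset\mathbb{R}$ is a finite set with $1<|X|<\infty$, and $d\ge 1$. For $S\subset\mathbb{Z}^d$, $W(S)$ is the set of all finite subsets of $S$, and $W=W(\mathbb{Z}^d)$. $X^S$ is the set of configurations on $S$ (functions $S\to X$). For disjoint $S,T$ and $x\in X^S$, $y\in X^T$, $xy\in X^{S\cup T}$ is the concatenation; $z_\Lambda$ is the restriction of $z$ to $\Lambda$. For $V\in W$, $\widehat{X_V}=\bigcup_{\emptyset\neq S\subset\mathbb{Z}^d\setminus V}X^S$ (configurations with nonempty, finite or infinite, support outside $V$). A random field is a probability measure $P$ on $X^{\mathbb{Z}^d}$ with the $\sigma$-algebra generated by cylinder sets; $P_S$ denotes its marginal on $X^S$, $S\subset\mathbb{Z}^d$. All random fields are assumed positive: $P_V(x)>0$ for all $V\in W$, $x\in X^V$. A full conditional distribution of $P$ is a system $Q_P=\{Q_V^z, z\in\widehat{X_V}, V\in W\}$ of probability distributions $Q_V^z$ on $X^V$ consisting of conditional probabilities of $P$: for $z\in X^S$ with $\emptyset\ne S\in W(\mathbb{Z}^d\setminus V)$ finite, $Q_V^z(x)=P_{V\cup S}(xz)/P_S(z)$; and for infinite $S\subset\mathbb{Z}^d\setminus V$ and $P_S$-almost every $z\in X^S$, $Q_V^z(x)=\lim_{n\to\infty}P_{V\cup\Lambda_n}(xz_{\Lambda_n})/P_{\Lambda_n}(z_{\Lambda_n})$,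 $x\in X^V$, for any increasing sequence of nonempty finite sets $\Lambda_n$ with $\bigcup_n\Lambda_n=S$ (the exceptional null set may depend on $V$, $S$ and the sequence); for the remaining infinite boundary conditions $z$ the distribution $Q_V^z$ is arbitrary. *)

(* Defs.v *)
From HB Require Import structures.
From mathcomp Require Import all_boot all_order all_algebra finmap.
From mathcomp Require Import all_classical all_reals all_analysis.

Set Implicit Arguments.
Unset Strict Implicit.
Unset Printing Implicit Defensive.

Import Order.TTheory GRing.Theory Num.Theory.
Import numFieldNormedType.Exports.

Local Open Scope classical_set_scope.
Local Open Scope ring_scope.

(* The bound 1 < |X| is bundled so that X, hence every X^S, is canonically
   pointed, as measurable types must be. *)
Record state_space (R : realType) := StateSpace {
  states : {fset R};
  states_gt1 : (1 < #|` states|)%N }.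

Definition spin (R : realType) (X : state_space R) : Type := states X.

Section spin_instances.
Context (R : realType) (X : state_space R).

HB.instance Definition _ := Finite.on (spin X).

Lemma spin_inhabited : exists _ : spin X, true.
Proof.
have : (0 < #|` states X|)%N by exact: ltn_trans (states_gt1 X).
by rewrite cardfs_gt0 => /fset0Pn[x Xx]; exists [` Xx]%fset.
Qed.

HB.instance Definition _ := isPointed.Build (spin X) (xchoose spin_inhabited).

End spin_instances.

Definition site (d : nat) := 'rV[int]_d.

Definition cylinders (I : Type) (E : Type) : set (set (I -> E)) :=
  [set C | exists (F : set I) (x : I -> E),
    finite_set F /\ C = [set w | forall i, F i -> w i = x i]].

Notation config X I := (g_sigma_algebraType (@cylinders I (spin X))).

Definition random_field (R : realType) (X : state_space R) (d : nat) :=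
  probability (config X (site d)) R.

Section configurations.
Context (R : realType) (X : state_space R) (d : nat).
Implicit Types S T : set (site d).

Definition restrict_to S (w : config X (site d)) : config X S :=
  fun i => w (val i).

Definition subrestrict S T (sub : T `<=` S) (z : config X S) : config X T :=
  fun i => z (SigSub (mem_set (sub _ (set_mem (valP i))))).

Lemma concat_subproof S T (i : site d) :
  i \in S `|` T -> ~ S i -> i \in T.
Proof. by move=> /set_mem[//|Ti] _; exact: mem_set. Qed.

(* Total on overlapping S and T, where x prevails; only used when they are
   disjoint. *)
Definition concat S T (x : config X S) (y : config X T) : config X (S `|` T) :=
  fun i => match pselect (S (val i)) with
           | left iS => x (SigSub (mem_set iS))
           | right iNS => y (SigSub (concat_subproof (valP i) iNS))
           end.

Lemma measurable_restrict_to S : measurable_fun setT (@restrict_to S).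
Proof.
apply: (@measurability _ _ (config X (site d)) (config X S) setT
  (@restrict_to S) (@cylinders S (spin X))) => //.
move=> _ [_ [F [x [finF ->]]] <-]; rewrite setTI.
rewrite (_ : _ @^-1` _ =
  \bigcap_(i in F) [set w : config X (site d) | w (val i) = x i]).
  apply: fin_bigcap_measurable => // i _; apply: sub_sigma_algebra.
  exists [set val i], (fun=> x i); split; first exact: finite_set1.
  by apply/seteqP; split => w /= wE; [move=> _ -> | exact: wE].
by apply/seteqP; split => w /=; exact.
Qed.

HB.instance Definition _ S :=
  isMeasurableFun.Build _ _ _ _ (@restrict_to S) (@measurable_restrict_to S).

Definition marginal (P : random_field X d) S : probability (config X S) R :=
  distribution P (@restrict_to S).

Definition mass S (mu : probability (config X S) R) (x : config X S) : R :=
  fine (mu [set x]).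

Definition positive (P : random_field X d) :=
  forall (V : {fset site d}) (x : config X [set` V]), 0 < mass (marginal P _) x.

Record boundary (V : {fset site d}) := Boundary {
  bsupp : set (site d);
  bsupp_neq0 : bsupp !=set0;
  bsupp_out : bsupp `<=` ~` [set` V];
  bval : config X bsupp }.

Definition cond_system := forall V : {fset site d},
  boundary V -> probability (config X [set` V]) R.

Definition cond_mass (P : random_field X d) (V : {fset site d}) S
    (z : config X S) (x : config X [set` V]) : R :=
  mass (marginal P _) (concat x z) / mass (marginal P S) z.

(* For infinite S the null set may depend on V, S and the sequence L,
   and the distributions of Q are unconstrained on these null sets. *)
Definition full_conditional_distribution (P : random_field X d)
    (Q : cond_system) :=
  forall (V : {fset site d}) S (S0 : S !=set0) (SV : S `<=` ~` [set` V]),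
    (finite_set S -> forall (z : config X S) (x : config X [set` V]),
       mass (Q V (Boundary S0 SV z)) x = cond_mass P z x)
    /\
    (infinite_set S ->
       forall (L : nat -> {fset site d}) (LS : forall n, [set` L n] `<=` S),
         (forall n, L n != fset0) ->
         (forall n, L n `<=` L n.+1)%fset ->
         \bigcup_n [set` L n] = S ->
         {ae marginal P S, forall z : config X S,
            forall x : config X [set` V],
              (fun n => cond_mass P (subrestrict (LS n) z) x) @ \oo
                --> mass (Q V (Boundary S0 SV z)) x}).

End configurations.

(* Main.v *)
Require Import Defs.
From mathcomp Require Import all_boot all_order all_algebra finmap.
From mathcomp Require Import all_classical all_reals all_analysis.

(** Only the finite boundary conditions matter.  Let V and T be disjoint
    nonempty finite sets of sites, x and z configurations on them.  Dividing by
    the positive numbers P_T(z) and P_V(x) in turn, the full conditional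
    distribution prescribes P(xz) / P(z) (boundary z outside V) as well as
    P(xz) / P(x) (boundary x outside T).  As P' has the same conditional
    probabilities,
      P(z) / P'(z) = P(xz) / P'(xz) = P(x) / P'(x),
    that is, P(x) P'(z) = P'(x) P(z) ([fcd_cylmass_cross]).  Here T may be a
    single site outside V, which exists because the lattice is infinite
    ([fresh_site]).  Summing over the finitely many states at that site
    ([sum_cylmass_site]) gives P(x) = P'(x) ([fcd_cylmass_eq]).  So P and P'
    agree on cylinders.  Adding the empty set makes these a family stable under
    intersection, which generates the sigma-algebra, and two probability
    measures that agree on such a family are equal. *)

Import Order.TTheory GRing.Theory Num.Theory.

Local Open Scope classical_set_scope.
Local Open Scope ring_scope.

Set Implicit Arguments.
Unset Strict Implicit.
Unset Printing Implicit Defensive.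

Lemma fresh_site (d : nat) (V : {fset site d}) :
  (0 < d)%N -> exists t : site d, t \notin V.
Proof.
case: d V => [//|d] V _; apply: contrapT => noT.
pose diag (n : nat) : site d.+1 := const_mx n%:Z.
have diag_inj : injective diag.
  by move=> m n /matrixP/(_ 0 0); rewrite !mxE => -[].
apply: infinite_nat; rewrite (_ : setT = diag @^-1` [set` V]).
  by apply: finite_preimage => [m n _ _|]; [exact: diag_inj|exact: finite_fset].
apply/seteqP; split => // n _ /=.
by apply: contrapT => /negP nV; apply: noT; exists (diag n).
Qed.

Section cylinder_masses.
Context (R : realType) (X : state_space R) (d : nat).
Implicit Types (F : set (site d)) (V T : {fset site d}).
Implicit Types (w : config X (site d)) (P : random_field X d).

(** Indexing cylinders by configurations on the whole lattice, of which only
    the restriction to the base matters, avoids concatenations: the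
    configuration xz on the union is just another restriction of the same w. *)
Definition cylinder F w : set (config X (site d)) :=
  [set u | forall i, F i -> u i = w i].

Definition cylmass P F w : R := fine (P (cylinder F w)).

Lemma measurable_cylinder F w : finite_set F -> measurable (cylinder F w).
Proof. by move=> finF; apply: sub_sigma_algebra; exists F, w. Qed.

Lemma cylmassE P F w : finite_set F -> P (cylinder F w) = (cylmass P F w)%:E.
Proof.
move=> finF; rewrite fineK//; apply: fin_num_measure.
exact: measurable_cylinder.
Qed.

Lemma mass_marginal_restrict_to P F w :
  mass (marginal P F) (restrict_to (S := F) w) = cylmass P F w.
Proof.
rewrite /mass /cylmass /marginal /distribution /= /pushforward.
congr (fine (P _)); apply/seteqP; split => u /=.
  by move=> uw i Fi; exact: (congr1 (@^~ (SigSub (mem_set Fi))) uw).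
move=> uw; apply/funext => i; apply: uw; exact: set_mem (valP i).
Qed.

Lemma concat_restrict_to S F w :
  concat (restrict_to (S := S) w) (restrict_to (S := F) w) =
  restrict_to (S := S `|` F) w.
Proof. by apply/funext => i; rewrite /concat; case: pselect. Qed.

Lemma cond_mass_restrict_to P V F w :
  cond_mass P (restrict_to (S := F) w) (restrict_to (S := [set` V]) w) =
  cylmass P ([set` V] `|` F) w / cylmass P F w.
Proof.
by rewrite /cond_mass concat_restrict_to !mass_marginal_restrict_to.
Qed.

Lemma cylmass_gt0 P V w : positive P -> 0 < cylmass P [set` V] w.
Proof. by move=> Ppos; rewrite -mass_marginal_restrict_to; exact: Ppos. Qed.

(** The cylinders over a single site partition the space of configurations. *)
Lemma sum_cylmass_site P (t : site d) w :
  \sum_(a \in [set: spin X])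
    cylmass P [set t] (fun i => if i == t then a else w i) = 1.
Proof.
pose C a := cylinder [set t] (fun i => if i == t then a else w i).
have inC a u : C a u <-> u t = a.
  by split=> [/(_ t erefl)|<- i ->]; rewrite eqxx.
have mC a : measurable (C a) by apply: measurable_cylinder; exact: finite_set1.
have finX : finite_set [set: spin X] by exact: finite_finset.
apply: EFin_inj; rewrite -fsumEFin//.
under eq_fsbigr do rewrite -cylmassE//.
have trivC : trivIset [set: spin X] C.
  by move=> a b _ _ [u [/inC <- /inC]].
rewrite -(measure_fin_bigcup P finX trivC)//.
rewrite -[RHS](@probability_setT _ _ _ P); congr (P _).
by apply/seteqP; split => // u _; exists (u t) => //; exact/inC.
Qed.

(** Conditioning in both directions is needed: V given T only equates
    P(xz) / P'(xz) with P(z) / P'(z), and T given V equates the same joint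
    ratio with P(x) / P'(x). *)
Lemma fcd_cylmass_cross P P' (Q : cond_system X d) V T w :
  positive P -> positive P' ->
  full_conditional_distribution P Q -> full_conditional_distribution P' Q ->
  [set` V] !=set0 -> [set` T] !=set0 -> [set` T] `<=` ~` [set` V] ->
  cylmass P [set` V] w * cylmass P' [set` T] w =
  cylmass P' [set` V] w * cylmass P [set` T] w.
Proof.
move=> Ppos P'pos PQ P'Q V0 T0 TV.
have VT : [set` V] `<=` ~` [set` T] by move=> i Vi /TV; exact.
have cond_eq (A B : {fset site d})
    (B0 : [set` B] !=set0) (BA : [set` B] `<=` ~` [set` A]) :
    cylmass P ([set` A] `|` [set` B]) w / cylmass P [set` B] w =
    cylmass P' ([set` A] `|` [set` B]) w / cylmass P' [set` B] w.
  rewrite -!cond_mass_restrict_to.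
  have [PAB _] := PQ A _ B0 BA; have [P'AB _] := P'Q A _ B0 BA.
  by rewrite -(PAB (finite_fset B)) -(P'AB (finite_fset B)).
have cross (A B : {fset site d})
    (B0 : [set` B] !=set0) (BA : [set` B] `<=` ~` [set` A]) :
    cylmass P ([set` A] `|` [set` B]) w * cylmass P' [set` B] w =
    cylmass P' ([set` A] `|` [set` B]) w * cylmass P [set` B] w.
  apply/eqP; rewrite -eqr_div; first exact/eqP/cond_eq.
    by rewrite gt_eqF//; exact: cylmass_gt0.
  by rewrite gt_eqF//; exact: cylmass_gt0.
have eqT := cross V T T0 TV.
have := cross T V V0 VT; rewrite setUC => eqV.
have joint0 : cylmass P ([set` V] `|` [set` T]) w != 0.
  by rewrite -set_fsetU gt_eqF//; exact: cylmass_gt0.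
have joint0' : cylmass P' ([set` V] `|` [set` T]) w != 0.
  by rewrite -set_fsetU gt_eqF//; exact: cylmass_gt0.
apply: (mulfI joint0); apply: (mulfI joint0').
rewrite !(mulrA (cylmass P' _ _)) mulrACA [RHS]mulrACA.
by rewrite -eqV eqT [LHS]mulrACA [RHS]mulrACA; congr (_ * _); exact: mulrC.
Qed.

Lemma fcd_cylmass_eq P P' (Q : cond_system X d) V w : (0 < d)%N ->
  positive P -> positive P' ->
  full_conditional_distribution P Q -> full_conditional_distribution P' Q ->
  [set` V] !=set0 -> cylmass P [set` V] w = cylmass P' [set` V] w.
Proof.
move=> d0 Ppos P'pos PQ P'Q V0.
have [t tV] := fresh_site V d0.
(* Varying the state at t alone does not change the mass over V. *)
pose wt a : config X (site d) := fun i => if i == t then a else w i.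
have cylV P0 a : cylmass P0 [set` V] w = cylmass P0 [set` V] (wt a).
  have wtV i : i \in V -> wt a i = w i.
    by rewrite /wt; case: eqP => [->|//]; rewrite (negPf tV).
  rewrite /cylmass; congr (fine (P0 _)).
  by apply/seteqP; split => u uw i Vi; rewrite uw// wtV.
have set1t : [set` [fset t]%fset] = [set t] by exact: set_fset1.
have cross a : cylmass P [set` V] w * cylmass P' [set t] (wt a) =
               cylmass P' [set` V] w * cylmass P [set t] (wt a).
  rewrite (cylV P a) (cylV P' a) -set1t.
  apply: fcd_cylmass_cross PQ P'Q V0 _ _ => //.
    by rewrite set1t; exists t.
  by rewrite set1t => _ -> /=; exact/negP.
have finX : finite_set [set: spin X] by exact: finite_finset.
rewrite -[LHS]mulr1 -(sum_cylmass_site P' t w) -[RHS]mulr1.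
rewrite -(sum_cylmass_site P t w) !mulr_fsumr//.
by apply: eq_fsbigr => a _; exact: cross.
Qed.

(** The empty set has to be added because cylinders are nonempty, whereas two
    of them may be disjoint. *)
Definition cylinders0 : set (set (config X (site d))) :=
  @cylinders (site d) (spin X) `|` [set set0].

Lemma cylinders0I : setI_closed cylinders0.
Proof.
move=> A B [|->]; last by rewrite set0I; right.
move=> [F [x [finF ->]]] [|->]; last by rewrite setI0; right.
move=> [G [y [finG ->]]].
have [[u [ux uy]]|none] := pselect (cylinder F x `&` cylinder G y !=set0).
  left; exists (F `|` G), u; split; first by rewrite finite_setU.
  apply/seteqP; split => v /=.
    by move=> [vx vy] i [Fi|Gi]; [rewrite vx// ux | rewrite vy// uy].
  by move=> vu; split=> i Di; rewrite vu; [exact: ux|left|exact: uy|right].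
right; apply/seteqP; split => // v v_in; apply: none; by exists v.
Qed.

End cylinder_masses.

(* Equality of measures is on measurable sets: the library leaves the value of
   a measure on non-measurable sets unconstrained. *)
Theorem theorem12 (R : realType) (X : state_space R) (d : nat) (hd : (0 < d)%N)
    (P P' : random_field X d) (hP : positive P) (hP' : positive P') :
  (exists Q : cond_system X d,
      full_conditional_distribution P Q /\
      full_conditional_distribution P' Q) ->
  forall A : set (config X (site d)), measurable A -> P A = P' A.
Proof.
move=> [Q [PQ P'Q]] A mA.
have setT_cyl (x : config X (site d)) : setT = cylinder set0 x.
  by apply/seteqP; split => // u _ i.
have cylP F x : finite_set F -> P (cylinder F x) = P' (cylinder F x).
  move=> finF; have [->|F0] := eqVneq F set0.
    by rewrite -setT_cyl !probability_setT.
  rewrite !cylmassE//; congr EFin; rewrite -(fset_setK finF).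
  apply: fcd_cylmass_eq PQ P'Q _ => //.
  by rewrite fset_setK//; exact/set0P.
apply: (@g_sigma_algebra_measure_unique _ _ _ (@cylinders0 R X d) _
  (fun=> setT)) => //.
- by move=> C [|->] //; exact: sub_sigma_algebra.
- by move=> n; left; exists set0, (fun=> point); split=> //; exact: setT_cyl.
- by rewrite bigcup_const//; exists 0%N.
- exact: cylinders0I.
- move=> C [|->]; last by rewrite !measure0.
  by move=> [F [x [finF ->]]]; exact: cylP.
- by move=> n; exact: le_lt_trans (probability_le1 P measurableT) (ltry 1).
- apply: smallest_sub mA => [|C cC]; first exact: smallest_sigma_algebra.
  by apply: sub_sigma_algebra; left.
Qed.
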